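(* Let $F:\mathbf{Comp}\to\mathbf{Comp}$ be a 1-mecw functor. If $X$ is a skeletally generated compact Hausdorff space, then the space $FX$ is skeletally generated.
   Context: All spaces are Hausdorff and all maps are continuous. $\mathbf{Comp}$ is the category of compact Hausdorff spaces (compacta) and continuous maps. A map $f:X\to Y$ between topological spaces is skeletal if for each nowhere dense subset $A\subset Y$ the preimage $f^{-1}(A)$ is nowhere dense in $X$. An inverse spectrum $\mathcal S=\{X_\alpha,p_\alpha^\beta,\Sigma\}$ over a directed partially ordered set $\Sigma$ is an $\omega$-spectrum if: each $X_\alpha$ has countable weight; $\Sigma$ is $\omega$-complete, i.e. each countable subset of $\Sigma$ has a smallest upper bound in $\Sigma$; and $\mathcal S$ is $\omega$-continuous, i.e. for any countable directed subset $\Sigma'\subset\Sigma$ with $\gamma=\sup\Sigma'$ the limit map $\lim p_\alpha^\gamma:X_\gamma\to\lim\{X_\alpha,p_\alpha^\beta,\Sigma'\}$ is a homeomorphism. A compact Hausdorff space $X$ is skeletally generated if it is homeomorphic to the limit of an inverse (continuous) $\omega$-spectrum $\{X_\alpha,\pi_\alpha^\beta,\Sigma\}$ consisting of metrizable compacta and surjective skeletal bonding projections $\pi_\alpha^\beta:X_\beta\to X_\alpha$. A functor $F:\mathbf{Comp}\to\mathbf{Comp}$ is: monomorphic (resp. epimorphic) if $Ff$ is injective (resp. surjective) for every injective (resp. surjective) map $f$ between compacta; continuous if it preserves limits of inverse spectra of compacta, i.e. for each inverse spectrum $\mathcal S$ of compacta over a directed set the natural map $F(\lim\mathcal S)\to\lim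 F\mathcal S$ is a homeomorphism; weight-preserving if $w(FX)\le w(X)$ for each infinite compactum $X$, where $w$ denotes the weight. A commutative square of continuous maps between compacta, with maps $\tilde f:\tilde X\to\tilde Y$, $p_X:\tilde X\to X$, $p_Y:\tilde Y\to Y$, $f:X\to Y$ and $p_Y\circ\tilde f=f\circ p_X$, is bicommutative if $\tilde f(p_X^{-1}(x))=p_Y^{-1}(f(x))$ for all $x\in X$. $F$ preserves finite 1-preimages if it preserves the bicommutativity of such squares in which $f,\tilde f$ are injective, $p_X$ is bijective and $X$ is finite. A 1-mecw functor is a monomorphic, epimorphic, continuous, weight-preserving functor that preserves finite 1-preimages. *)

(* Defs.v *)
From HB Require Import structures.
From mathcomp Require Import all_boot all_order all_algebra.
From mathcomp Require Import all_classical all_reals all_analysis.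

Set Implicit Arguments.
Unset Strict Implicit.
Unset Printing Implicit Defensive.

Import Order.TTheory.

Local Open Scope classical_set_scope.
Local Open Scope card_scope.
Local Open Scope order_scope.

Section topology.

Definition homeomorphism (X Y : topologicalType) (f : X -> Y) : Prop :=
  continuous f /\ exists g : Y -> X, [/\ cancel f g, cancel g f & continuous g].

Definition homeomorphic (X Y : topologicalType) : Prop :=
  exists f : X -> Y, homeomorphism f.

Definition nowhere_dense (X : topologicalType) (A : set X) : Prop :=
  interior (closure A) = set0.

Definition skeletal (X Y : topologicalType) (f : X -> Y) : Prop :=
  forall A : set Y, nowhere_dense A -> nowhere_dense (f @^-1` A).

Definition metrizable (R : realType) (X : topologicalType) : Prop :=
  exists M : metricType R, homeomorphic X M.

(* The weight w(X) is the cardinality of any [minimal_basis] of X. *)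
Definition minimal_basis (X : topologicalType) (B : set (set X)) : Prop :=
  basis B /\ forall C : set (set X), basis C -> B #<= C.

Definition weight_le (X Y : topologicalType) : Prop :=
  exists (B : set (set X)) (C : set (set Y)),
    [/\ minimal_basis B, minimal_basis C & B #<= C].

Definition bicommutative (X' Y' X Y : topologicalType)
    (f' : X' -> Y') (pX : X' -> X) (pY : Y' -> Y) (f : X -> Y) : Prop :=
  pY \o f' = f \o pX /\
  forall x : X, f' @` (pX @^-1` [set x]) = pY @^-1` [set f x].

End topology.

Record compactum := Compactum {
  compactum_space :> topologicalType;
  compactum_compact : compact [set: compactum_space];
  compactum_hausdorff : hausdorff_space compactum_space }.

Section posets.
Context (d : Order.disp_t) (S : porderType d).

Definition directed (A : set S) : Prop :=
  A !=set0 /\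
  forall a b, A a -> A b -> exists c, [/\ A c, a <= c & b <= c].

(* [countable] includes the finite sets, so c exists also for A = set0. *)
Definition omega_complete : Prop :=
  forall A : set S, countable A -> exists c, isLub A c.

End posets.

HB.instance Definition _ (T : choiceType) (A : set T) :=
  SubType.copy (set_type A) {x : T | x \in A}.

HB.instance Definition _ (d : Order.disp_t) (S : porderType d) (A : set S) :=
  [SubChoice_isSubPOrder of set_type A by <: with d].

Record spectrum (d : Order.disp_t) (S : porderType d) := Spectrum {
  spectrum_space :> S -> compactum;
  bond : forall a b : S, a <= b ->
    continuousType (spectrum_space b) (spectrum_space a);
  bond_id : forall (a : S) (aa : a <= a) x, bond aa x = x;
  bond_comp : forall (a b c : S) (ab : a <= b) (bc : b <= c) (ac : a <= c) x,
    bond ab (bond bc x) = bond ac x }.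

Section limit.
Context (d : Order.disp_t) (S : porderType d) (X : spectrum S).

Definition threads : set (prod_topology (fun a : S => X a)) :=
  [set x | forall (a b : S) (ab : a <= b), bond X ab (x b) = x a].

Definition threads_proj (a : S) (x : set_type threads) : X a := set_val x a.

Lemma threads_proj_continuous (a : S) : continuous (@threads_proj a).
Proof.
move=> x; apply: (@continuous_comp _ (prod_topology (fun a : S => X a))
  _ set_val (proj a) x).
  exact: (@initial_continuous (set_type threads) _ set_val x).
exact: (@proj_continuous S (fun a : S => X a)).
Qed.

Lemma threads_hausdorff : hausdorff_space (set_type threads).
Proof.
move=> p q pq.
apply/eq_sig_hprop; first by move=> ? ? ?; exact: Prop_irrelevance.
apply: functional_extensionality_dep => a.
apply: (@compactum_hausdorff (X a)) => U V Up Vq.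
have [x [Ux Vx]] := pq _ _ (@threads_proj_continuous a p U Up)
                           (@threads_proj_continuous a q V Vq).
by exists (threads_proj a x).
Qed.

Lemma threads_closed : closed threads.
Proof.
move=> x clx a b ab; apply: (@compactum_hausdorff (X a)) => U V Ux Vx.
pose pr (c : S) := @proj S (fun a : S => X a) c.
have prc c : continuous (pr c : prod_topology (fun a : S => X a) -> _).
  exact: (@proj_continuous S (fun a : S => X a)).
have UVx : nbhs x ((bond X ab \o pr b) @^-1` U `&` pr a @^-1` V).
  apply: filterI; last exact: (prc a x V Vx).
  exact: (prc b x _ (@cts_fun _ _ (bond X ab) (x b) U Ux)).
have [y [yt [Uy Vy]]] := clx _ UVx.
exists (y a); split; last exact: Vy.
by rewrite -(yt _ _ ab).
Qed.

Lemma threads_compact : compact [set: set_type threads].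
Proof.
have cpt : compact threads.
  have cptT : compact [set: prod_topology (fun a : S => X a)].
    have := @tychonoff S (fun a : S => X a) (fun=> setT)
      (fun a => @compactum_compact (X a)).
    by congr compact; rewrite predeqE.
  exact: subclosed_compact threads_closed cptT _.
move=> F FF _; have [|x [xt clx]] := cpt (set_val @ F) _.
  by apply: (@filterE _ F) => y; exact: (set_valP y).
exists (SigSub (mem_set xt)); split=> // A B FA [_ [[W oW <-] Wx WB]].
have nW : nbhs x W by apply: open_nbhs_nbhs; split.
have [|_ [[y Ay <-] Wy]] := clx (set_val @` A) W _ nW.
  by apply: (@filterS _ F _ A) FA => y Ay; exists y.
by exists y; split=> //; exact: WB.
Qed.

Definition lim_spectrum : compactum :=
  Compactum threads_compact threads_hausdorff.

Definition lim_proj (a : S) : continuousType lim_spectrum (X a) :=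
  mkcts (@threads_proj_continuous a).

Lemma lim_projP (a b : S) (ab : a <= b) x :
  bond X ab (lim_proj b x) = lim_proj a x.
Proof. exact: (set_valP x). Qed.

Section lim_map.
Context (L : compactum) (q : forall a : S, continuousType L (X a)).
Context (qP : forall (a b : S) (ab : a <= b) x, bond X ab (q b x) = q a x).

Lemma lim_map_threads (x : L) : threads (fun a => q a x).
Proof. by move=> a b ab; exact: qP. Qed.

Definition lim_map (x : L) : lim_spectrum :=
  SigSub (mem_set (lim_map_threads x)).

End lim_map.

End limit.

Section subspectrum.
Context (d : Order.disp_t) (S : porderType d) (X : spectrum S) (A : set S).

Definition subspectrum : spectrum (set_type A) :=
  @Spectrum _ (set_type A) (fun a => X (val a))
    (fun a b ab => @bond _ _ X (val a) (val b) ab)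
    (fun a aa => @bond_id _ _ X (val a) aa)
    (fun a b c ab bc ac => @bond_comp _ _ X (val a) (val b) (val c) ab bc ac).

Context (c : S) (Ac : ubound A c).

Definition sub_bond (a : set_type A) : continuousType (X c) (subspectrum a) :=
  bond X (Ac (set_valP a)).

Lemma sub_bondP (a b : set_type A) (ab : a <= b) x :
  bond subspectrum ab (sub_bond b x) = sub_bond a x.
Proof. exact: (@bond_comp _ _ X (val a) (val b) c). Qed.

(* The limit map of the bondings X c -> X a, a in A, for an upper bound c. *)
Definition sub_lim_map : X c -> lim_spectrum subspectrum :=
  lim_map sub_bondP.

End subspectrum.

Arguments sub_lim_map {d S} X {A c} Ac _.

Definition omega_continuous (d : Order.disp_t) (S : porderType d)
    (X : spectrum S) : Prop :=
  forall (A : set S) (c : S) (Ac : isLub A c), countable A -> directed A ->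
    homeomorphism (sub_lim_map X Ac.1).

Definition omega_spectrum (d : Order.disp_t) (S : porderType d)
    (X : spectrum S) : Prop :=
  [/\ directed [set: S],
      forall a : S, @second_countable (X a),
      omega_complete S &
      omega_continuous X].

Definition skeletally_generated (R : realType) (X : compactum) : Prop :=
  exists (d : Order.disp_t) (S : porderType d) (Y : spectrum S),
    [/\ omega_spectrum Y,
        forall a : S, metrizable R (Y a),
        forall (a b : S) (ab : a <= b),
          set_surj setT setT (bond Y ab) /\ skeletal (bond Y ab) &
        homeomorphic X (lim_spectrum Y)].

Record comp_functor := CompFunctor {
  fobj :> compactum -> compactum;
  fmap : forall X Y : compactum,
    continuousType X Y -> continuousType (fobj X) (fobj Y);
  fmap_id : forall X : compactum, fmap (idfun : continuousType X X) = idfun;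
  fmap_comp : forall (X Y Z : compactum)
      (g : continuousType Y Z) (f : continuousType X Y),
    fmap (g \o f : continuousType X Z) = fmap g \o fmap f }.

Section functor.
Context (F : comp_functor).

Section spectrum_image.
Context (d : Order.disp_t) (S : porderType d) (X : spectrum S).

Lemma fmap_bond_id (a : S) (aa : a <= a) x : fmap F (bond X aa) x = x.
Proof.
have -> : bond X aa = (idfun : continuousType (X a) (X a)).
  by apply/continuousEP => y; exact: bond_id.
by rewrite fmap_id.
Qed.

Lemma fmap_bond_comp (a b c : S) (ab : a <= b) (bc : b <= c) (ac : a <= c) x :
  fmap F (bond X ab) (fmap F (bond X bc) x) = fmap F (bond X ac) x.
Proof.
have -> : bond X ac = (bond X ab \o bond X bc : continuousType (X c) (X a)).
  by apply/continuousEP => y /=; rewrite bond_comp.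
by rewrite fmap_comp.
Qed.

Definition fspectrum : spectrum S :=
  @Spectrum _ S (fun a => F (X a)) (fun a b ab => fmap F (bond X ab))
    fmap_bond_id fmap_bond_comp.

Lemma fmap_lim_projP (a b : S) (ab : a <= b) x :
  bond fspectrum ab (fmap F (lim_proj X b) x) = fmap F (lim_proj X a) x.
Proof.
have -> : lim_proj X a =
    (bond X ab \o lim_proj X b : continuousType (lim_spectrum X) (X a)).
  by apply/continuousEP => y /=; rewrite lim_projP.
by rewrite fmap_comp.
Qed.

(* The natural map F (lim X) -> lim (F X). *)
Definition flim_map : F (lim_spectrum X) -> lim_spectrum fspectrum :=
  lim_map fmap_lim_projP.

End spectrum_image.

Arguments flim_map {d S} X _.

Definition monomorphic : Prop :=
  forall (X Y : compactum) (f : continuousType X Y),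
    injective f -> injective (fmap F f).

Definition epimorphic : Prop :=
  forall (X Y : compactum) (f : continuousType X Y),
    set_surj setT setT f -> set_surj setT setT (fmap F f).

Definition continuous_functor : Prop :=
  forall (d : Order.disp_t) (S : porderType d) (X : spectrum S),
    directed [set: S] -> homeomorphism (flim_map X).

Definition weight_preserving : Prop :=
  forall X : compactum, infinite_set [set: X] -> weight_le (F X) X.

Definition preserves_finite_1preimages : Prop :=
  forall (X' Y' X Y : compactum)
    (f' : continuousType X' Y') (pX : continuousType X' X)
    (pY : continuousType Y' Y) (f : continuousType X Y),
    injective f -> injective f' -> bijective pX -> finite_set [set: X] ->
    bicommutative f' pX pY f ->
    bicommutative (fmap F f') (fmap F pX) (fmap F pY) (fmap F f).

Definition mecw1 : Prop :=
  [/\ monomorphic, epimorphic, continuous_functor, weight_preserving &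
      preserves_finite_1preimages].

End functor.

Arguments flim_map F {d S} X _.

(* Main.v *)
From HB Require Import structures.
From mathcomp Require Import all_boot all_order all_algebra.
From mathcomp Require Import finmap lra.
From mathcomp Require Import all_classical all_reals all_analysis.
Require Import Defs.

(* A 1-mecw functor need not preserve skeletal surjections: two isolated points
   of X may be glued into an isolated point of Y. It does preserve a skeletal
   surjection p : X -> Y, X metrizable, with one-point fibers over the isolated
   points of Y. Indeed a nonempty open U in FX contains the image of an element
   of some F L, L a finite set, and L can be moved inside U as long as its points
   stay in small neighborhoods E_l; since the isolated points of Y have one-point
   fibers, the sets p(E_l), which have nonempty interior, have distinct
   representatives y_l with pairwise disjoint neighborhoods W_l. Discarding from X
   the points over W_l outside of E_l and collapsing each E_l gives a space that
   still maps onto Y with one-point fibers over the y_l, so that preservation of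
   finite 1-preimages shows that Fp(U) contains a nonempty open set.

   In the spectrum of a skeletally generated compactum, call an index rigid if
   no isolated point of its space has two preimages further up. The supremum of an
   increasing sequence of indices, each of which splits all the isolated points of
   the previous one that can be split, is rigid. As skeletal maps send isolated
   points to isolated points, the indices above a rigid one are rigid, and F maps
   the part of the spectrum above a rigid index to a spectrum as required. *)

Set Implicit Arguments.
Unset Strict Implicit.
Unset Printing Implicit Defensive.

Import Order.TTheory GRing.Theory Num.Theory numFieldNormedType.Exports.

Local Open Scope classical_set_scope.

(** * Compact Hausdorff spaces *)

Section compact_hausdorff.

Lemma surjTP (X Y : Type) (f : X -> Y) :
  set_surj setT setT f <-> forall y, exists x, f x = y.
Proof.
split=> [fs y|fs y _]; first by have [x _ <-] := fs y I; exists x.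
by have [x <-] := fs y; exists x.
Qed.

Lemma compactum_closed (X : compactum) (A : set X) : closed A -> compact A.
Proof.
by move=> cA; apply: subclosed_compact cA (@compactum_compact X) _.
Qed.

Lemma closed_image (X : compactum) (T : topologicalType) (f : X -> T)
    (A : set X) :
  hausdorff_space T -> continuous f -> closed A -> closed (f @` A).
Proof.
move=> hT cf cA; apply: compact_closed => //.
by apply: continuous_compact; [exact: continuous_subspaceT|exact: compactum_closed].
Qed.

(** Closed subsets of [X] are compact, so [f] is a closed map; preimages under the inverse are
    images under [f]. *)
Lemma bij_homeomorphism (X : compactum) (T : topologicalType) (f : X -> T) :
  hausdorff_space T -> continuous f -> injective f ->
  (forall y, exists x, f x = y) -> homeomorphism f.
Proof.
move=> hT cf fI fS; split=> //; have [g gE] := choice fS.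
exists g; split => //; first by move=> x; apply: fI; rewrite gE.
apply/continuous_closedP => A cA.
suff -> : g @^-1` A = f @` A by exact: closed_image.
apply/seteqP; split=> [y Ay|_ [x Ax <-]]; first by exists (g y).
by rewrite /preimage /=; have -> : g (f x) = x by apply: fI; rewrite gE.
Qed.

(** A surjection of compacta is a closed map, hence a quotient map: for any section [s] of [q], the
    preimage of [A] under [g \o s] is the [q]-image of the preimage of [A] under [g]. *)
Lemma quotient_factor (X M N : compactum) (q : continuousType X M)
    (g : continuousType X N) :
  (forall m, exists x, q x = m) -> (forall x x', q x = q x' -> g x = g x') ->
  exists h : continuousType M N, forall x, h (q x) = g x.
Proof.
move=> qS qg; have [s sE] := choice qS.
have hE x : g (s (q x)) = g x by apply: qg; rewrite sE.
suff ch : continuous (g \o s) by exists (mkcts ch).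
apply/continuous_closedP => A cA.
suff -> : (g \o s) @^-1` A = q @` (g @^-1` A).
  apply: closed_image; [exact: compactum_hausdorff|exact: cts_fun|].
  by move/continuous_closedP: (@cts_fun _ _ g); exact.
apply/seteqP; split=> [y Ay|_ [x Ax <-]]; first by exists (s y).
by rewrite /preimage /= hE.
Qed.

Lemma set_type_compact (T : topologicalType) (A : set T) :
  compact A -> compact [set: set_type A].
Proof.
move=> cpt F FF _; have [|x [xt clx]] := cpt (set_val @ F) _.
  by apply: (@filterE _ F) => y; exact: (set_valP y).
exists (SigSub (mem_set xt)); split=> // B C FB [_ [[W oW <-] Wx WC]].
have nW : nbhs x W by apply: open_nbhs_nbhs; split.
have [|_ [[y By <-] Wy]] := clx (set_val @` B) W _ nW.
  by apply: (@filterS _ F _ B) FB => y By; exists y.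
by exists y; split=> //; exact: WC.
Qed.

Lemma injective_hausdorff (S T : topologicalType) (f : S -> T) :
  hausdorff_space T -> continuous f -> injective f -> hausdorff_space S.
Proof.
move=> hT cf fI p q pq; apply: fI; apply: hT => U V Up Vq.
have [x [Ux Vx]] := pq _ _ (cf p U Up) (cf q V Vq).
by exists (f x).
Qed.

Lemma set_val_continuous (T : topologicalType) (A : set T) :
  continuous (set_val : set_type A -> T).
Proof. exact: initial_continuous. Qed.

Lemma set_type_hausdorff (T : topologicalType) (A : set T) :
  hausdorff_space T -> hausdorff_space (set_type A).
Proof.
move=> hT; apply: injective_hausdorff (@set_val_continuous _ A) _ => //.
Qed.

Definition sub_compactum (T : topologicalType) (A : set T)
    (hT : hausdorff_space T) (cA : compact A) : compactum :=
  Compactum (set_type_compact cA) (@set_type_hausdorff _ A hT).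

(** The source of all auxiliary quotients below. [T] need not be compact, so it may be a power of
    the real line. *)
Lemma image_compactum (X : compactum) (T : topologicalType) (f : X -> T) :
  hausdorff_space T -> continuous f ->
  exists (M : compactum) (q : continuousType X M) (i : continuousType M T),
    [/\ injective i, forall m, exists x, q x = m & forall x, i (q x) = f x].
Proof.
move=> hT cf.
have cR : compact (range f).
  apply: continuous_compact; first exact: continuous_subspaceT.
  exact: compactum_compact.
pose q x : sub_compactum hT cR := SigSub (mem_set (imageP f (I : setT x))).
have cq : continuous q.
  by apply/continuous_comp_initial => x; exact: cf.
exists (sub_compactum hT cR), (mkcts cq), (mkcts (@set_val_continuous _ (range f))).
split=> // m; have [x _ xm] := set_valP m; exists x; exact: val_inj.
Qed.

Lemma closed_compactum (X : compactum) (A : set X) : closed A ->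
  exists (M : compactum) (i : continuousType M X), injective i /\ range i = A.
Proof.
move=> cA; exists (sub_compactum (@compactum_hausdorff X) (compactum_closed cA)).
exists (mkcts (@set_val_continuous _ A)); split; first by move=> x y; exact: val_inj.
apply/seteqP; split=> [_ [x _ <-]|x Ax]; first exact: set_valP.
by exists (SigSub (mem_set Ax)).
Qed.

Lemma finite_open (X : compactum) (A : set X) : finite_set [set: X] -> open A.
Proof.
move=> fX; rewrite -(setCK A); apply: closed_openC.
have /accessible_finite_set_closed := hausdorff_accessible (@compactum_hausdorff X).
by apply; apply: sub_finite_set fX.
Qed.

Lemma finite_continuous (X : compactum) (T : topologicalType) (f : X -> T) :
  finite_set [set: X] -> continuous f.
Proof. by move=> fX; apply/continuousP => A _; exact: finite_open. Qed.

Lemma hausdorff_closed1 (X : compactum) (x : X) : closed [set x].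
Proof.
by apply: accessible_closed_set1; apply: hausdorff_accessible; exact: compactum_hausdorff.
Qed.

End compact_hausdorff.

(** * Limits of spectra and their images under a functor *)

Lemma fiber_closed (X Y : compactum) (f : continuousType X Y) (y : Y) :
  closed [set x | f x = y].
Proof.
have : closed (f @^-1` [set y]); last by [].
by move/continuous_closedP: (@cts_fun _ _ f); apply; exact: hausdorff_closed1.
Qed.

Lemma prod_topology_continuous (L : topologicalType) (I : eqType)
    (T : I -> topologicalType) (f : L -> prod_topology T) :
  (forall i, continuous (fun x => f x i)) -> continuous f.
Proof.
move=> cf x; apply/cvg_sup => i; apply/cvg_image.
  apply/seteqP; split => // y _.
  by exists (dfwith (f x) i y) => //; rewrite dfwithin.
move=> U; rewrite nbhs_simpl /= => Ux.
exists ([set g : prod_topology T | U (g i)]); first exact: (cf i x U Ux).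
apply/seteqP; split => [_ [g Ug <-] //|y Uy].
by exists (dfwith (f x) i y); rewrite /= dfwithin.
Qed.

Section cones.
Context (d : Order.disp_t) (S : porderType d).
Local Open Scope order_scope.

(** By directedness the sets [C a] form a filter base; a cluster point of it lies in each closed
    [C a]. *)
Lemma directed_closed_meet (X : compactum) (C : S -> set X) :
  directed [set: S] -> (forall a, closed (C a)) -> (forall a, C a !=set0) ->
  (forall a b, a <= b -> C b `<=` C a) -> exists x, forall a, C a x.
Proof.
move=> [[s0 _] dirS] cC C0 Cle.
have PF : ProperFilter (filter_from [set: S] C).
  apply: filter_from_proper => // ; apply: filter_from_filter; first by exists s0.
  move=> a b _ _; have [c [_ ac bc]] := dirS a b I I.
  by exists c => // x Cx; split; [exact: Cle ac _ Cx|exact: Cle bc _ Cx].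
have [|x [_ clx]] := @compactum_compact X (filter_from [set: S] C) PF _.
  exact: filterT.
exists x => a; apply: cC => B Bx; apply: clx => //.
by exists a.
Qed.

(** Some [q s] has its fiber through [x] inside [U]: otherwise the closed sets of points outside [U]
    in the fiber of [q a] through [x] would have a common point, which no [q a] separates from [x].
    As [q s] is closed, a whole neighborhood of that fiber, saturated under [q s], lies in [U]. *)
Lemma cone_nbhs (L : compactum) (M : S -> compactum)
    (q : forall a, continuousType L (M a)) :
  directed [set: S] ->
  (forall a b, a <= b -> forall x x', q b x = q b x' -> q a x = q a x') ->
  (forall x x', (forall a, q a x = q a x') -> x = x') ->
  forall (U : set L) x, open U -> U x ->
  exists (s : S) (O : set (M s)),
    [/\ open O, O (q s x) & forall x', O (q s x') -> U x'].
Proof.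
move=> dirS mon sep U x oU Ux.
have [s sE] : exists s, forall x', q s x' = q s x -> U x'.
  apply: contrapT => /forallNP nU.
  pose C a := [set x' | q a x' = q a x] `&` ~` U.
  have [|||x' Cx'] := @directed_closed_meet L C dirS.
  - move=> a; apply: closedI; last exact: open_closedC.
    exact: fiber_closed.
  - by move=> a; have /existsNP[x' /not_implyP[? ?]] := nU a; exists x'.
  - by move=> a b ab x' [/= xx' Ux']; split => //=; exact: mon xx'.
  - have [s0 _] := dirS.1; have [_] := Cx' s0; apply.
    by rewrite (sep x' x) // => a; have [] := Cx' a.
exists s, (~` (q s @` (~` U))); split.
- apply: closed_openC; apply: closed_image; last exact: open_closedC.
    exact: compactum_hausdorff.
  exact: cts_fun.
- by move=> [x' nUx' /sE].
- by move=> x' nx'; apply: contrapT => Ux'; apply: nx'; exists x'.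
Qed.

Lemma lim_map_continuous (X : spectrum S) (L : compactum)
    (q : forall a, continuousType L (X a))
    (qP : forall (a b : S) (ab : a <= b) x, bond X ab (q b x) = q a x) :
  continuous (lim_map qP).
Proof.
apply/continuous_comp_initial.
suff : continuous ((fun x a => q a x) : L -> prod_topology (fun a : S => X a)).
  by [].
by apply: prod_topology_continuous => a; exact: cts_fun.
Qed.

Lemma lim_map_inj (X : spectrum S) (L : compactum)
    (q : forall a, continuousType L (X a))
    (qP : forall (a b : S) (ab : a <= b) x, bond X ab (q b x) = q a x) x x' :
  lim_map qP x = lim_map qP x' <-> forall a, q a x = q a x'.
Proof.
split=> [xx' a|xx']; first by rewrite -[q a x]/(lim_proj X a (lim_map qP x)) xx'.
by apply: val_inj; apply: functional_extensionality_dep => a; exact: xx'.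
Qed.

(** Surjectivity is compactness of [L]: the fibers over the coordinates of a thread are closed,
    nonempty and decreasing. *)
Lemma lim_map_homeomorphism (X : spectrum S) (L : compactum)
    (q : forall a, continuousType L (X a))
    (qP : forall (a b : S) (ab : a <= b) x, bond X ab (q b x) = q a x) :
  directed [set: S] -> (forall x x', (forall a, q a x = q a x') -> x = x') ->
  (forall a y, exists x, q a x = y) -> homeomorphism (lim_map qP).
Proof.
move=> dirS sep qS; apply: bij_homeomorphism.
- exact: threads_hausdorff.
- exact: lim_map_continuous.
- by move=> x x' /lim_map_inj; exact: sep.
move=> z.
have [|||x xE] := @directed_closed_meet L
    (fun a => [set x | q a x = lim_proj X a z]) dirS.
- move=> a.
  exact: fiber_closed.
- by move=> a; have [x] := qS a (lim_proj X a z); exists x.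
- by move=> a b ab x /= xz; rewrite -(qP a b ab) xz lim_projP.
exists x; apply: val_inj; apply: functional_extensionality_dep => a; exact: xE.
Qed.

End cones.

Section functor_lemmas.
Context (F : comp_functor).

Lemma fmapE (X Y Z : compactum) (g : continuousType Y Z)
    (f : continuousType X Y) (h : continuousType X Z) :
  (forall x, h x = g (f x)) -> forall a, fmap F h a = fmap F g (fmap F f a).
Proof.
move=> hE a; have -> : h = (g \o f : continuousType X Z) by apply/continuousEP.
by rewrite fmap_comp.
Qed.

Lemma fmap_idE (X : compactum) (f : continuousType X X) :
  (forall x, f x = x) -> forall a, fmap F f a = a.
Proof.
move=> fE a; have -> : f = (idfun : continuousType X X) by apply/continuousEP.
by rewrite fmap_id.
Qed.

Hypotheses (monoF : monomorphic F) (contF : continuous_functor F).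
Context (d : Order.disp_t) (S : porderType d) (dirS : directed [set: S]).
Local Open Scope order_scope.

(** The maps [q a] embed [L] in the limit of [X]. A monomorphic [F] keeps this embedding injective,
    and by continuity of [F] a point of [F (lim_spectrum X)] is determined by its coordinates. *)
Lemma functor_separates (X : spectrum S) (L : compactum)
    (q : forall a, continuousType L (X a)) :
  (forall (a b : S) (ab : a <= b) x, bond X ab (q b x) = q a x) ->
  (forall x x', (forall a, q a x = q a x') -> x = x') ->
  forall x x', (forall a, fmap F (q a) x = fmap F (q a) x') -> x = x'.
Proof.
move=> qP sep x x' xx'.
pose j : continuousType L (lim_spectrum X) := mkcts (@lim_map_continuous _ _ X L q qP).
have jI : injective j by move=> y y' /lim_map_inj; exact: sep.
apply: (monoF jI).
have [_ [g [fg _ _]]] := contF X dirS.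
apply: (can_inj fg); apply: (iffRL (lim_map_inj _ _ _)) => a.
have jE y : q a y = lim_proj X a (j y) by [].
by have := xx' a; rewrite !(fmapE jE).
Qed.

(* [F X] is embedded in the limit of the [F (M a)], for [F] is monomorphic. *)
Lemma functor_nbhs (X : compactum) (M : S -> compactum)
    (q : forall a, continuousType X (M a)) :
  (forall a m, exists x, q a x = m) ->
  (forall a b, a <= b -> forall x x', q b x = q b x' -> q a x = q a x') ->
  (forall x x', (forall a, q a x = q a x') -> x = x') ->
  forall (U : set (F X)) x, open U -> U x ->
  exists (s : S) (O : set (F (M s))),
    [/\ open O, O (fmap F (q s) x) & forall x', O (fmap F (q s) x') -> U x'].
Proof.
move=> qS mon sep.
(* As the [q a] are onto and identify fewer points for larger [a], they induce bonding maps that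
   make the [M a] a spectrum. *)
pose b_ a b (ab : a <= b) := cid (quotient_factor (qS b) (mon a b ab)).
pose bnd a b (ab : a <= b) : continuousType (M b) (M a) := sval (b_ a b ab).
have bndE a b (ab : a <= b) x : bnd a b ab (q b x) = q a x by exact: (svalP (b_ a b ab)).
have bid a (aa : a <= a) x : bnd a a aa x = x.
  by have [y <-] := qS a x; rewrite bndE.
have bcomp a b c (ab : a <= b) (bc : b <= c) (ac : a <= c) x :
    bnd a b ab (bnd b c bc x) = bnd a c ac x.
  by have [y <-] := qS c x; rewrite !bndE.
pose Y := @Spectrum _ S M bnd bid bcomp.
apply: cone_nbhs => //.
- move=> a b ab x x' xx'.
  by rewrite !(@fmapE _ _ _ (bnd a b ab) (q b) (q a)) // xx'.
- exact: (@functor_separates Y X q).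
Qed.

End functor_lemmas.

(** * Density of elements with finite support *)

(** A copy of [T] with base point [t], for [compact_second_countable] and [cantor_surj], which are
    about pointed spaces; a compactum may be empty. *)
Definition pointed_at (T : Type) (t : T) : Type := T.

Section pointed_at.
Context (R : realType) (M : pseudoMetricType R) (t : M).
HB.instance Definition _ := PseudoMetric.copy (pointed_at t) M.
HB.instance Definition _ := isPointed.Build (pointed_at t) t.
End pointed_at.

Lemma pseudometric_second_countable (R : realType) (M : pseudoMetricType R) :
  compact [set: M] -> @second_countable M.
Proof.
move=> cM; have [[t]|M0] := pselect (exists t : M, True); last first.
  exists set0 => //; split=> // x; exfalso; apply: M0; by exists x.
by have [B cB bB] := @compact_second_countable R (pointed_at t) cM; exists B.
Qed.

Definition cantor_compactum : compactum :=
  Compactum cantor_space_compact cantor_space_hausdorff.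

Lemma metrizable_cantor (R : realType) (X : compactum) (x : X) :
  metrizable R X ->
  exists f : continuousType cantor_compactum X, forall y, exists z, f z = y.
Proof.
move=> [M [h [ch [g [hg gh cg]]]]].
have cM : compact [set: M].
  have <- : range h = setT by apply/seteqP; split=> // y _; exists (g y).
  apply: continuous_compact; first exact: continuous_subspaceT.
  exact: compactum_compact.
have [f cf] := @cantor_surj R (pointed_at (h x)) cM (@metric_hausdorff _ M).
have cgf : continuous (g \o f : cantor_compactum -> X).
  by move=> z; apply: continuous_comp; [exact: cf|exact: cg].
exists (mkcts cgf) => y.
by have [z _ fz] := (@surj _ _ _ _ f) (h y) I; exists z; rewrite /= /mkcts /= fz.
Qed.

Section dense.
Context (R : realType) (F : comp_functor).
Hypotheses (monoF : monomorphic F) (epiF : epimorphic F).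
Hypothesis (contF : continuous_functor F).

Let trunc (n : nat) (x : cantor_compactum) : cantor_compactum :=
  fun i => if (i < n)%N then x i else false.

Let trunc_continuous n : continuous (trunc n).
Proof.
apply: prod_topology_continuous => i; rewrite /trunc.
case: (i < n)%N; last by move=> x; exact: cvg_cst.
exact: (@proj_continuous _ (fun=> bool) i).
Qed.

Let nat_directed : directed [set: nat].
Proof.
split; first by exists 0%N.
move=> a b _ _; exists (maxn a b); split=> //; rewrite leEnat; first exact: leq_maxl.
exact: leq_maxr.
Qed.

(** A nonempty metrizable [X] is an image of the Cantor set, so [a] lifts to some [c] there. The
    truncations to the first [n] coordinates have finite images [M n] and together separate points;
    hence some [F (M n)] already sees a neighborhood of [c], and truncating [c] does not leave
    it. *)
Lemma functor_finite_dense (X : compactum) (U : set (F X)) (a : F X) :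
  metrizable R X -> open U -> U a ->
  exists (K : compactum) (g : continuousType K X) (k : F K),
    finite_set [set: K] /\ U (fmap F g k).
Proof.
move=> mX oU Ua; have [[x _]|X0] := pselect (exists x : X, True); last first.
  exists X, idfun, a; split; last by rewrite fmap_idE.
  suff -> : [set: X] = set0 by [].
  by apply/seteqP; split=> // x _; apply: X0; exists x.
have [f /surjTP fS] := metrizable_cantor x mX.
have [c ca] := iffLR (surjTP _) (epiF fS) a.
pose U' := fmap F f @^-1` U.
have oU' : open U' by apply: (iffLR (continuousP _) (@cts_fun _ _ (fmap F f))).
have Mi n := cid (image_compactum (@cantor_space_hausdorff) (@trunc_continuous n)).
pose M n := sval (Mi n).
have qi n := cid (svalP (Mi n)); pose q n : continuousType _ (M n) := sval (qi n).
have ii n := cid (svalP (qi n)).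
pose i n : continuousType (M n) cantor_compactum := sval (ii n).
have iI n : injective (i n) by have [] := svalP (ii n).
have qS n m : exists x, q n x = m by have [_] := svalP (ii n).
have iq n z : i n (q n z) = trunc n z by have [_ _] := svalP (ii n).
have qE n z z' : q n z = q n z' <-> (forall j, (j < n)%N -> z j = z' j).
  split=> [zz j jn|zz].
    by have := congr1 (fun m => i n m j) zz; rewrite !iq /trunc jn.
  apply: iI; rewrite !iq; apply/funext => j; rewrite /trunc.
  by case: ifP => // /zz.
have [| | | | |n [V [oV Vc VU]]] := @functor_nbhs F monoF contF _ nat nat_directed
    cantor_compactum M q _ _ _ U' c.
- exact: qS.
- move=> k l kl z z' /qE zz; apply/qE => j jk; apply: zz.
  by apply: leq_trans jk _; rewrite -leEnat.
- by move=> z z' zz; apply/funext => j; have /qE := zz j.+1; exact.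
- exact: oU'.
- by rewrite /U' /= ca.
exists (M n), (f \o i n : continuousType _ _), (fmap F (q n) c); split.
  suff -> : [set: M n] =
      range (fun t : {ffun 'I_n -> bool} =>
        q n (fun j : nat => if insub j is Some k then t k else false)).
    by apply: finite_image; exact: finite_finset.
  apply/seteqP; split=> // m _; have [z <-] := qS n m.
  exists [ffun k : 'I_n => z k] => //; apply/qE => j jn.
  by rewrite insubT ffunE.
(* Truncation is idempotent, so [q n \o i n] is the identity: [c] and its truncation have the same
   image in [F (M n)]. *)
rewrite fmap_comp /=; apply: VU.
rewrite -(@fmapE F _ _ _ (q n) (i n) (q n \o i n : continuousType _ _)) //.
rewrite fmap_idE // => m /=; have [z <-] := qS n m; rewrite iq.
by apply/qE => j jn; rewrite /trunc jn.
Qed.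

End dense.

(** * Collapsing neighborhoods of finitely many points *)

Section finite_families.

Lemma finite_near (T : topologicalType) (L : choiceType) (P : L -> set T) (y : T) :
  finite_set [set: L] -> (forall l, nbhs y (P l)) -> nbhs y [set z | forall l, P l z].
Proof.
move=> /finite_fsetP[D DE] nP.
have /filterS : nbhs y (\bigcap_(l in [set` D]) P l) by apply: filter_bigI.
by apply=> z Pz l; apply: Pz; rewrite -DE.
Qed.

(** Removing one point from a nonempty open set without isolated points leaves a set of the same
    kind. *)
Lemma open_avoid (Y : compactum) (V : set Y) (s : seq Y) :
  open V -> V !=set0 -> (forall v, V v -> ~ open [set v]) ->
  exists2 v, V v & v \notin s.
Proof.
elim: s V => [|y s IH] V oV [v Vv] niV; first by exists v.
have [||u [Vu uy]|u [Vu uy] us] := IH (V `&` ~` [set y]).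
- by apply: openI => //; apply: closed_openC; exact: hausdorff_closed1.
- apply: contrapT => /forallNP Vy.
  have VE : V = [set y].
    apply/seteqP; split=> [u Vu|u ->].
      by apply: contrapT => uy; apply: (Vy u); split.
    by have [<-//|vy] := pselect (v = y); case: (Vy v); split.
  have yV : V y by rewrite VE.
  by case: (niV y yV); rewrite -VE.
- exact: niV.
- by exists u => //; rewrite inE negb_or us andbT; apply/eqP.
Qed.

(** Representatives are chosen one at a time. An isolated point of [V l] belongs to no other member
    of the family and can be taken at once; a [V l] without isolated points has room to avoid the
    finitely many points already chosen. *)
Lemma distinct_representatives (L : choiceType) (Y : compactum) (V : L -> set Y) :
  finite_set [set: L] -> (forall l, open (V l)) -> (forall l, V l !=set0) ->
  (forall l l' y, open [set y] -> V l y -> V l' y -> l = l') ->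
  exists y : L -> Y, injective y /\ forall l, V l (y l).
Proof.
move=> /finite_seqP[s sE] oV V0 iV.
suff [y [yV yI]] : exists y : L -> Y, (forall l, V l (y l)) /\ {in s &, injective y}.
  exists y; split=> // l l'; apply: yI; have : [set` s] l by rewrite -sE.
    by [].
  by have : [set` s] l' by rewrite -sE.
elim: s {sE} => [|l s [y [yV yI]]]; first by have [y yV] := choice V0; exists y.
suff [v Vv vs] : exists2 v, V l v & forall l', l' \in s -> y l' = v -> l' = l.
  exists (fun z => if z == l then v else y z); split=> [z|z z'].
    by case: eqP => // ->.
  rewrite !inE; case: (eqVneq z l) => [->|zl] /=; case: (eqVneq z' l) => [->|z'l] //=.
  - by move=> _ z's yv; rewrite (vs z').
  - by move=> zs _ yv; rewrite (vs z).
  - exact: yI.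
have [[v [Vv ov]]|niV] := pselect (exists v, V l v /\ open [set v]).
  by exists v => // l' _ yv; apply: (iV _ _ v) => //; rewrite -yv.
have [|v Vv vs] := @open_avoid Y (V l) [seq y l' | l' <- s] (oV l) (V0 l).
  by move=> v Vv ov; apply: niV; exists v.
by exists v => // l' l's yv; move/negP: vs; case; rewrite -yv; exact: map_f.
Qed.

Lemma disjoint_neighborhoods (L : choiceType) (Y : compactum) (y : L -> Y)
    (V : L -> set Y) :
  finite_set [set: L] -> injective y -> (forall l, open (V l)) ->
  (forall l, V l (y l)) ->
  exists W : L -> set Y, [/\ forall l, open (W l), forall l, W l (y l),
    forall l, W l `<=` V l & forall l l' z, W l z -> W l' z -> l = l'].
Proof.
move=> fL yI oV Vy.
have /choice[G GP] (p : L * L) : exists AB : set Y * set Y, p.1 <> p.2 ->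
    [/\ nbhs (y p.1) AB.1, nbhs (y p.2) AB.2 & forall z, AB.1 z -> AB.2 z -> False].
  case: p => l l' /=.
  have [ll|ll] := pselect (l = l'); first by exists (set0, set0).
  have := @compactum_hausdorff Y; rewrite open_hausdorff => /(_ (y l) (y l')).
  case=> [|AB [yA yB] [oA oB AB0]]; first by apply/eqP => /yI.
  exists AB => _; split.
  - by apply: open_nbhs_nbhs; split => //; exact/set_mem.
  - by apply: open_nbhs_nbhs; split => //; exact/set_mem.
  - move=> z Az Bz; have : (AB.1 `&` AB.2) z by [].
    by rewrite (eqP AB0).
(* The pairs [G (l, l')] and [G (l', l)] are chosen independently, so [N l] is cut by the relevant
   half of each. *)
pose N l := [set z | V l z /\ forall l', l <> l' -> (G (l, l')).1 z /\ (G (l', l)).2 z].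
have nN l : nbhs (y l) (N l).
  apply: filterI; first by apply: open_nbhs_nbhs.
  apply: finite_near => // l'.
  have [->|ll] := pselect (l = l'); first by apply: filterS (filterT) => z _.
  have [n1 _ _] := GP (l, l') ll.
  have [_ n2 _] := GP (l', l) (fun e => ll (esym e)).
  by apply: filterS2 n1 n2 => z ? ? _.
exists (fun l => interior (N l)); split.
- by move=> l; exact: open_interior.
- exact: nN.
- by move=> l z /interior_subset[].
- move=> l l' z /interior_subset[_ zl] /interior_subset[_ zl'].
  apply: contrapT => ll; have [_ _ G0] := GP (l, l') ll.
  by apply: (G0 z); [have [] := zl l' ll|have [] := zl' l (fun e => ll (esym e))].
Qed.

End finite_families.

Section fat_quotient.
Context (R : realType) (X : compactum).

(** [M] is the image of [X] in the power of the real line indexed by [A]. *)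
Lemma functions_image (A : set (X -> R)) : (forall f, A f -> continuous f) ->
  exists (M : compactum) (q : continuousType X M),
    (forall m, exists x, q x = m) /\
    forall z z', q z = q z' <-> (forall f, A f -> f z = f z').
Proof.
move=> cA; pose I : eqType := set_type A.
pose e (x : X) : prod_topology (fun _ : I => R) := fun f => set_val f x.
have hP : hausdorff_space (prod_topology (fun _ : I => R)).
  by apply: hausdorff_product => _; exact: Rhausdorff.
have ce : continuous e.
  by apply: prod_topology_continuous => f; apply: cA; exact: set_valP.
have [M [q [i [iI qS iq]]]] := image_compactum hP ce.
exists M, q; split=> // z z'; split=> [zz f Af|zz].
  have := congr1 (fun m => i m (SigSub (mem_set Af))) zz.
  by rewrite !iq.
by apply: iI; rewrite !iq; apply/funext => f; apply: zz; exact: set_valP.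
Qed.

(** A Urysohn function [h] vanishes at [x] and is 1 at [x'] and at the points [g k] other than [x].
    Clamping it to the interval from 1/3 to 2/3 makes it constant near every point where [h] is 0 or
    1. *)
Lemma locally_constant_separation (K : compactum) (g : K -> X) (x x' : X) :
  finite_set [set: K] -> x <> x' ->
  exists f : X -> R, [/\ continuous f, f x <> f x' &
    forall k, nbhs (g k) [set z | f z = f (g k)]].
Proof.
move=> fK xx'.
pose B := (range g `|` [set x']) `\` [set x].
have cB : closed B.
  have /accessible_finite_set_closed := hausdorff_accessible (@compactum_hausdorff X).
  apply; apply: finite_setD; rewrite finite_setU; split=> //.
  exact: finite_image.
have nX := compact_normal (@compactum_hausdorff X) (@compactum_compact X).
have AB : [set x] `&` B = set0.
  by apply/seteqP; split=> // z [-> [_]]; apply.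
have := normal_uniform_separator nX (@hausdorff_closed1 _ x) cB AB.
move=> /(@uniform_separatorP _ R)[h [ch _ h0 h1]].
pose f : X -> R := cst (3^-1)%R \max (cst (2 / 3)%R \min h).
have hx : h x = 0%R by apply: h0; exists x.
have hB z : B z -> h z = 1%R by move=> Bz; apply: h1; exists z.
have f0 z : (h z < 3^-1)%R -> f z = (3^-1)%R.
  by move=> hz; rewrite /f /= maxEle minEle; case: ifP; case: ifP; lra.
have f1 z : (2 / 3 < h z)%R -> f z = (2 / 3)%R.
  by move=> hz; rewrite /f /= maxEle minEle; case: ifP; case: ifP; lra.
exists f; split.
- move=> z; apply: (@continuous_max R X (cst _) (cst _ \min h)); first exact: cvg_cst.
  by apply: (@continuous_min R X (cst _) h); [exact: cvg_cst|exact: ch].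
- have hx' : h x' = 1%R by apply: hB; split; [right|move=> x'x; apply: xx'].
  have -> : f x = (3^-1)%R by apply: f0; rewrite hx; lra.
  have -> : f x' = (2 / 3)%R by apply: f1; rewrite hx'; lra.
  lra.
- move=> k; have [kx|kx] := pselect (g k = x).
    have -> : f (g k) = (3^-1)%R by apply: f0; rewrite kx hx; lra.
    rewrite kx.
    have : nbhs x (h @^-1` [set r | r < 3^-1]%R).
      by apply: ch; apply: open_nbhs_nbhs; split; [exact: open_lt|rewrite /= hx; lra].
    by apply: filterS => z; exact: f0.
  have gB : h (g k) = 1%R by apply: hB; split => //; left; exists k.
  have -> : f (g k) = (2 / 3)%R by apply: f1; rewrite gB; lra.
  have : nbhs (g k) (h @^-1` [set r | 2 / 3 < r]%R).
    by apply: ch; apply: open_nbhs_nbhs; split; [exact: open_gt|rewrite /= gB; lra].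
  by apply: filterS => z; exact: f1.
Qed.

Context (F : comp_functor).
Hypotheses (monoF : monomorphic F) (contF : continuous_functor F).

(** The quotients of [X] are indexed by families [A] of continuous functions such that near each
    [g k] all members of [A] are constant on a common neighborhood. These families are closed under
    binary unions, hence directed, and separate points by [locally_constant_separation], so
    [functor_nbhs] applies. *)
Lemma functor_fat_nbhs (K : compactum) (g : K -> X) (U : set (F X)) (a : F X) :
  finite_set [set: K] -> open U -> U a ->
  exists (M : compactum) (q : continuousType X M) (V : set (F M)),
    [/\ open V, V (fmap F q a), forall x, V (fmap F q x) -> U x &
        forall k, nbhs (g k) [set z | q z = q (g k)]].
Proof.
move=> fK oU Ua.
pose P : set (set (X -> R)) := [set A | (forall f, A f -> continuous f) /\
  forall k, nbhs (g k) [set z | forall f, A f -> f z = f (g k)]].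
pose S := set_type P.
have leS (A B : S) : (A <= B)%O <-> (val A `<=` val B).
  by rewrite -subsetEset.
have SP (A : S) : P (val A) := set_valP A.
have Mi (A : S) := cid (functions_image (SP A).1).
pose M A := sval (Mi A).
have qi A := cid (svalP (Mi A)); pose q A : continuousType X (M A) := sval (qi A).
have qS A m : exists x, q A x = m by have [] := svalP (qi A).
have qE A z z' : q A z = q A z' <-> (forall f, val A f -> f z = f z').
  by have [_] := svalP (qi A).
have dirS : directed [set: S].
  split.
    have P0 : P set0 by split=> // k; apply: filterS filterT => z _ f [].
    by exists (SigSub (mem_set P0)).
  move=> A B _ _; have PAB : P (val A `|` val B).
    split=> [f [|]|k]; [exact: (SP A).1|exact: (SP B).1|].
    apply: filterS2 ((SP A).2 k) ((SP B).2 k) => z zA zB f [|]; [exact: zA|exact: zB].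
  exists (SigSub (mem_set PAB)); split=> //; apply/leS => f fA; [by left|by right].
have [| | | | |A [V [oV Va VU]]] := @functor_nbhs F monoF contF _ S dirS X M q _ _ _ U a.
- exact: qS.
- by move=> A B /leS AB x x' /qE xx; apply/qE => f /AB; exact: xx.
- move=> x x' xx; apply: contrapT => nxx.
  have [f [cf fx fk]] := locally_constant_separation g fK nxx.
  have Pf : P [set f] by split=> [_ ->//|k]; apply: filterS (fk k) => z zk _ ->.
  by apply: fx; have /qE := xx (SigSub (mem_set Pf)); apply.
- exact: oU.
- exact: Ua.
exists (M A), (q A), V; split=> // k; apply: filterS ((SP A).2 k) => z zk.
exact/qE.
Qed.

End fat_quotient.

(** * Preservation of skeletal maps *)

Lemma prod_hausdorff (S T : topologicalType) :
  hausdorff_space S -> hausdorff_space T -> hausdorff_space (S * T)%type.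
Proof.
move=> hS hT [p1 p2] [q1 q2] pq; congr pair.
  apply: hS => U V Up Vq.
  have [[x y] [/= Ux Vx]] := pq (fst @^-1` U) (fst @^-1` V) (cvg_fst Up) (cvg_fst Vq).
  by exists x.
apply: hT => U V Up Vq.
have [[x y] [/= Ux Vx]] := pq (snd @^-1` U) (snd @^-1` V) (cvg_snd Up) (cvg_snd Vq).
by exists y.
Qed.

Section skeletal_functor.
Context (R : realType) (F : comp_functor).
Hypotheses (monoF : monomorphic F) (epiF : epimorphic F).
Hypotheses (contF : continuous_functor F) (preF : preserves_finite_1preimages F).

(** The open set consists of the points of [F Y] all of whose preimages in [F Z'] lie in [N]. It is
    nonempty because preservation of 1-preimages leaves [fmap F yc a1] only the preimage
    [fmap F s a1]; it lies in the image of [U] because [F Z] maps onto [F Y]. *)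
Lemma functor_image_interior (X Y : compactum) (p : continuousType X Y)
    (U : set (F X)) (a : F X) :
  (forall y, exists x, p x = y) -> skeletal p -> metrizable R X ->
  (forall x x', open [set p x] -> p x = p x' -> x = x') ->
  open U -> U a ->
  exists V : set (F Y), [/\ open V, V !=set0 & V `<=` fmap F p @` U].
Proof.
move=> pS skp mX pI oU Ua.
have [K [g [k0 [fK Uk]]]] := functor_finite_dense monoF epiF contF mX oU Ua.
have [M [q [B [oO Oa OU fat]]]] := functor_fat_nbhs R monoF contF g fK oU Uk.
pose qg : continuousType K M := q \o g.
(* Points of [K] with the same image in [M] are merged, so that distinct [l] have disjoint fibers
   [E l]. *)
have [L [r [i [iI rS ir]]]] :=
  image_compactum (@compactum_hausdorff M) (@cts_fun _ _ qg).
pose a1 := fmap F r k0.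
have Oa1 : B (fmap F i a1).
  by rewrite -(@fmapE F _ _ _ i r qg) ?fmap_comp.
have fL : finite_set [set: L].
  suff -> : [set: L] = r @` setT by exact: finite_image.
  by apply/seteqP; split=> // l _; have [k <-] := rS l; exists k.
pose E l := [set x | q x = i l].
have cE l : closed (E l) by exact: fiber_closed.
pose V l := interior (p @` E l).
have V0 l : V l !=set0.
  apply/set0P/negP => /eqP V0; have [k kl] := rS l.
  have ndE : nowhere_dense (p @` E l).
    rewrite /nowhere_dense -(iffLR (closure_id _)) //.
    by apply: closed_image; [exact: compactum_hausdorff|exact: cts_fun|].
  have : interior (closure (p @^-1` (p @` E l))) (g k).
    apply: filterS (fat k) => x /= qx; apply: subset_closure; exists x => //.
    by rewrite /E /= qx -kl ir.
  by rewrite (skp _ ndE).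
have VE l y : V l y -> exists2 x, q x = i l & p x = y.
  by move=> /interior_subset[x qx <-]; exists x.
have [||y [yI yV]] := @distinct_representatives L Y V fL _ V0.
- by move=> l; exact: open_interior.
(* An isolated point has a one-point fiber under [p], and that point lies in only one [E l]. *)
- move=> l l' y oy /VE[x qx px] /VE[x' qx' px']; apply: iI.
  by rewrite -qx -qx'; congr (q _); apply: pI; rewrite px.
have [|W [oW Wy WV Wdisj]] := disjoint_neighborhoods fL yI _ yV.
  by move=> l; exact: open_interior.
(* [Z0] omits the points over [W l] outside of the fiber of [l]; its image [Z']
   in [M * Y] then has a single point over [y l]. *)
pose Z0 := [set x | forall l, W l (p x) -> q x = i l].
have cZ : closed Z0.
  have -> : Z0 = \bigcap_l (~` (p @^-1` W l) `|` E l).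
    apply/seteqP; split=> [x Zx l _|x Zx l Wx].
      by have [/Zx|] := pselect (W l (p x)); [right|left].
    by have [] := Zx l I.
  apply: closed_bigI => l _; apply: closedU => //; apply: open_closedC.
  exact: (iffLR (continuousP _) (@cts_fun _ _ p)).
have Z0W l y' : W l y' -> exists2 x, Z0 x & q x = i l /\ p x = y'.
  move=> Wl; have [x qx px] := VE _ _ (WV l _ Wl).
  by exists x => // l'; rewrite px => Wl'; rewrite (Wdisj _ _ _ Wl' Wl).
have [Z [j [jI jE]]] := closed_compactum cZ.
have Zj z : Z0 (j z) by rewrite -jE; exists z.
have jZ x : Z0 x -> exists z, j z = x by rewrite -jE => -[z _ <-]; exists z.
have hMY := prod_hausdorff (@compactum_hausdorff M) (@compactum_hausdorff Y).
pose e z := (q (j z), p (j z)).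
have ce : continuous e.
  by move=> z; apply: cvg_pair; apply: continuous_comp; exact: cts_fun.
have [Z' [t [m [mI tS mt]]]] := image_compactum hMY ce.
have cfm : continuous (fst \o m).
  by move=> z; apply: continuous_comp; [exact: cts_fun|exact: cvg_fst].
have csm : continuous (snd \o m).
  by move=> z; apply: continuous_comp; [exact: cts_fun|exact: cvg_snd].
pose pM : continuousType Z' M := mkcts cfm.
pose pY : continuousType Z' Y := mkcts csm.
have /choice[s0 s0E] l : exists z', m z' = (i l, y l).
  have [x Zx [qx px]] := Z0W l (y l) (Wy l).
  by have [z zx] := jZ x Zx; exists (t z); rewrite mt /e zx qx px.
pose s : continuousType L Z' := mkcts (@finite_continuous L Z' s0 fL).
pose yc : continuousType L Y := mkcts (@finite_continuous L Y y fL).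
have pMs l : pM (s l) = i l by rewrite -[LHS]/(m (s0 l)).1 s0E.
have pYs l : pY (s l) = yc l by rewrite -[LHS]/(m (s0 l)).2 s0E.
have pMt z : pM (t z) = q (j z) by rewrite -[LHS]/(m (t z)).1 mt.
have pYt z : pY (t z) = p (j z) by rewrite -[LHS]/(m (t z)).2 mt.
have bic : bicommutative s (idfun : continuousType L L) pY yc.
  split; first by apply/funext => l; exact: pYs.
  move=> l; apply/seteqP; split=> [_ [l0 l0l <-]|z'].
    by have <- : l0 = l := l0l; exact: pYs.
  have [z <-] := tS z'; rewrite /preimage /= pYt => pz.
  have {}pz : p (j z) = y l := pz.
  exists l => //; apply: mI; rewrite -[LHS]/(m (s0 l)) s0E mt /e pz.
  by rewrite (Zj z l) // pz.
have idB : bijective (idfun : L -> L) by exists idfun.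
have [||_ /(_ a1) fib] := preF _ _ idB fL bic.
- by [].
- move=> l l' /(congr1 m); rewrite -[m (s l)]/(m (s0 l)) -[m (s l')]/(m (s0 l')).
  by rewrite !s0E => -[_ /yI].
pose N := fmap F pM @^-1` B.
have oN : open N by exact: (iffLR (continuousP _) (@cts_fun _ _ (fmap F pM))).
exists (~` (fmap F pY @` (~` N))); split.
- apply: closed_openC; apply: closed_image; last exact: open_closedC.
    exact: compactum_hausdorff.
  exact: cts_fun.
- exists (fmap F yc a1) => -[c nNc pc].
  have : (fmap F pY @^-1` [set fmap F yc a1]) c by [].
  rewrite -fib => -[x]; rewrite /preimage /= fmap_idE // => -> cE'.
  apply: nNc; rewrite -cE'.
  by rewrite /N /= -(@fmapE F _ _ _ pM s i).
move=> b nb.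
(* Over [W l] a preimage is found in [E l]; outside all the [W l] nothing was omitted from [X]. *)
have pjS : set_surj setT setT (p \o j : continuousType Z Y).
  apply/surjTP => y'; have [[l Wl]|nW] := pselect (exists l, W l y').
    by have [x Zx [_ px]] := Z0W l y' Wl; have [z zx] := jZ x Zx; exists z; rewrite /= zx.
  have [x px] := pS y'; have [|z zx] := jZ x; last by exists z; rewrite /= zx.
  by move=> l; rewrite px => Wl; case: nW; exists l.
have [c cb] := iffLR (surjTP _) (epiF pjS) b.
exists (fmap F j c); last by rewrite -cb fmap_comp.
(* If the lift of [b] missed [U], then [fmap F t c] would be a preimage of [b] outside [N]. *)
apply: OU; apply: contrapT => nO; apply: nb; exists (fmap F t c).
  rewrite /N /= => Ot; apply: nO; move: Ot.
  rewrite -(@fmapE F _ _ _ pM t (q \o j : continuousType _ _)) ?fmap_comp //.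
by rewrite -(@fmapE F _ _ _ pY t (p \o j : continuousType _ _)).
Qed.

Lemma functor_skeletal (X Y : compactum) (p : continuousType X Y) :
  (forall y, exists x, p x = y) -> skeletal p -> metrizable R X ->
  (forall x x', open [set p x] -> p x = p x' -> x = x') ->
  skeletal (fmap F p).
Proof.
move=> pS skp mX pI A ndA; apply/eqP/negPn/negP => /set0P[a Ia].
have [V [oV [b Vb] VU]] :=
  functor_image_interior pS skp mX pI (open_interior _) Ia.
have : interior (closure A) b.
  apply: filterS (open_nbhs_nbhs (conj oV Vb)) => _ /VU[x /interior_subset clx <-].
  move=> C Cpx; have [z [Az Cz]] := clx _ (@cts_fun _ _ (fmap F p) x C Cpx).
  by exists (fmap F p z).
by rewrite ndA.
Qed.

End skeletal_functor.

(** * Countable weight and metrizability *)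

Section metrization.
Context (R : realType) (X : compactum) (g : nat -> X -> R).
Hypothesis g_cts : forall n, continuous (g n).
Hypothesis g01 : forall n x, (0 <= g n x <= 1)%R.
Hypothesis g_sep : forall x y, (forall n, g n x = g n y) -> x = y.
Local Open Scope ring_scope.

Let term x y n : R := `|g n x - g n y| / n.+1%:R.

(** Since the weights tend to 0, only finitely many terms matter at any given scale, which makes the
    metric topology no finer than that of [X]. *)
Definition weighted_dist (x y : X) : R := sup (range (term x y)).

Let term_le x y n : term x y n <= n.+1%:R^-1.
Proof.
rewrite /term ler_piMl // ler_norml.
by have /andP[] := g01 n x; have /andP[] := g01 n y; lra.
Qed.

Let has_sup_term x y : has_sup (range (term x y)).
Proof.
split; first by exists (term x y 0%N); exists 0%N.
exists 1 => _ [n _ <-]; apply: le_trans (term_le x y n) _.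
by rewrite invf_le1 // ler1n.
Qed.

Let term_dist x y n : term x y n <= weighted_dist x y.
Proof. by apply: (sup_upper_bound (has_sup_term x y)); exists n. Qed.

Let dist_le x y e : (forall n, term x y n <= e) -> weighted_dist x y <= e.
Proof.
move=> h; apply: sup_le_ub; first by have [] := has_sup_term x y.
by move=> _ [n _ <-].
Qed.

Let dist_xx x : weighted_dist x x = 0.
Proof.
have t0 n : term x x n = 0 by rewrite /term subrr normr0 mul0r.
apply/eqP; rewrite eq_le; apply/andP; split.
  by apply: dist_le => n; rewrite t0.
by rewrite -(t0 0%N).
Qed.

Let dist_pos x y : weighted_dist x y = 0 -> x = y.
Proof.
move=> d0; apply: g_sep => n; have := term_dist x y n; rewrite d0 /term.
rewrite pmulr_lle0 ?invr_gt0 ?ltr0n // normr_le0 subr_eq0.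
by move/eqP.
Qed.

Let dist_sym x y : weighted_dist x y = weighted_dist y x.
Proof.
by congr sup; congr (_ @` _); apply/funext => n; rewrite /term distrC.
Qed.

Let dist_triangle y x z :
  weighted_dist x z <= weighted_dist x y + weighted_dist y z.
Proof.
apply: dist_le => n; apply: le_trans (lerD (term_dist x y n) (term_dist y z n)).
by rewrite /term -mulrDl ler_wpM2r // ler_distD.
Qed.

(** A second name for [X], keeping the metric topology apart from the original one until the
    identity is shown to be a homeomorphism. *)
Definition weighted_metric : Type := X.
HB.instance Definition _ := Choice.copy weighted_metric X.
HB.instance Definition _ := @isMetric.Build R weighted_metric weighted_dist
  dist_xx dist_pos dist_sym dist_triangle.

Let weighted_continuous : continuous (id : X -> weighted_metric).
Proof.
move=> x U /nbhs_ballP[e /= e0]; rewrite ballEmdist => eU.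
(* The terms beyond [N] are bounded by their weights, the others by continuity. The bound is [e / 2]
   because a supremum of terms only yields a non-strict inequality. *)
have [N Ne] : exists N : nat, N.+1%:R^-1 < e / 2 :> R.
  have [|N] := @ltr_add_invr R 0 (e / 2); first lra.
  by rewrite add0r; exists N.
have : nbhs x [set y | forall n : 'I_N.+1, term x y n < e / 2].
  apply: finite_near => [|n]; first exact: finite_finset.
  have e2 : 0 < e / 2 by lra.
  have : nbhs x (g n @^-1` ball (g n x) (e / 2)) by apply: g_cts; exact: nbhsx_ballx.
  apply: filterS => y; rewrite /preimage /ball /= => xy.
  apply: le_lt_trans xy; rewrite /term ler_piMr //.
  by rewrite invf_le1 // ler1n.
apply: filterS => y xy; apply: eU => /=.
apply: (@le_lt_trans _ _ (e / 2)); last lra.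
apply: dist_le => n; have [nN|nN] := ltnP n N.+1.
  exact: ltW (xy (Ordinal nN)).
apply: le_trans (term_le x y n) _; apply: le_trans (ltW Ne).
by rewrite lef_pV2 ?posrE ?ltr0n // ler_nat ltnW.
Qed.

Lemma separating_sequence_metrizable : metrizable R X.
Proof.
exists weighted_metric, id; apply: bij_homeomorphism => //.
- exact: metric_hausdorff.
- by move=> y; exists y.
Qed.

End metrization.

Section second_countable.
Context (R : realType) (X : compactum).
Local Open Scope ring_scope.

Let separates (f : X -> R) (U V : set X) := [/\ continuous f,
  forall z, 0 <= f z <= 1, forall z, U z -> f z < 2^-1 &
  forall z, V z -> 2^-1 < f z].

(** Urysohn metrization: [g] picks a separating function for each coded pair of basic sets that
    admits one, and 0 at the remaining codes. Distinct points lie in basic sets forming a separable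
    pair, so the sequence distinguishes them. *)
Lemma second_countable_metrizable : @second_countable X -> metrizable R X.
Proof.
move=> [B cB [_ bB]].
have [s Bs] : exists s : nat -> set X, B `<=` range s.
  move: cB => /pfcard_geP[->|[f]]; first by exists (fun=> set0).
  exists f => U BU; have [n _ <-] := (@surj _ _ _ _ f) U BU.
  by exists n.
have /choice[g gP] n : exists f : X -> R, [/\ continuous f,
    forall z, 0 <= f z <= 1 & forall i j, n = choice.pickle (i, j) ->
      (exists h, separates h (s i) (s j)) -> separates f (s i) (s j)].
  have [[i [j [h [nij hP]]]]|nh] := pselect (exists i j h,
      n = choice.pickle (i, j) /\ separates h (s i) (s j)).
    exists h; have [? ? _ _] := hP; split => // i' j'; rewrite nij.
    by move=> /(pcan_inj choice.pickleK)[<- <-].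
  exists (cst 0); split=> [z|z|i j nij [h hP]]; [exact: cvg_cst|by rewrite lexx ler01|].
  by case: nh; exists i, j, h.
apply: (@separating_sequence_metrizable R X g).
- by move=> n; have [] := gP n.
- by move=> n; have [] := gP n.
move=> x y gxy; apply: contrapT => xy.
have nX := compact_normal (@compactum_hausdorff X) (@compactum_compact X).
have xy0 : [set x] `&` [set y] = set0.
  by apply/seteqP; split=> // z [-> /= xz]; apply: xy.
have := normal_uniform_separator nX (@hausdorff_closed1 _ x) (@hausdorff_closed1 _ y) xy0.
move=> /(@uniform_separatorP _ R)[h [ch h01 h0 h1]].
have hx : h x = 0 by apply: h0; exists x.
have hy : h y = 1 by apply: h1; exists y.
have [|U [BU Ux] Uh] := bB x [set z | h z < 2^-1].
  apply: (ch x [set r | r < 2^-1]); apply: open_nbhs_nbhs; split.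
    exact: open_lt.
  by rewrite /= hx; lra.
have [|V [BV Vy] Vh] := bB y [set z | 2^-1 < h z].
  apply: (ch y [set r | 2^-1 < r]); apply: open_nbhs_nbhs; split.
    exact: open_gt.
  by rewrite /= hy; lra.
have [i _ si] := Bs _ BU; have [j _ sj] := Bs _ BV.
have [_ _ /(_ i j erefl)] := gP (choice.pickle (i, j)).
case=> [|_ _ lt1 lt2].
  exists h; split=> // [z|z|z]; rewrite ?si ?sj; [|exact: Uh|exact: Vh].
  by have := h01 (h z); rewrite /= in_itv /=; apply; exists z.
have := lt1 x; have := lt2 y; rewrite si sj gxy => /(_ Vy) a1 /(_ Ux) a2.
by have := lt_trans a1 a2; rewrite ltxx.
Qed.

End second_countable.

Lemma second_countable_injective (X Y : compactum) (f : continuousType X Y) :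
  injective f -> @second_countable Y -> @second_countable X.
Proof.
move=> fI [B cB [oB bB]]; exists [set f @^-1` U | U in B].
  exact: card_le_trans (card_image_le _ _) cB.
split=> [_ [U BU <-]|x W /=].
  exact: (iffLR (continuousP _) (@cts_fun _ _ f) _ (oB _ BU)).
rewrite nbhsE => -[W' [oW' W'x] W'W].
have cfW : closed (f @` (~` W')).
  apply: closed_image; last exact: open_closedC.
    exact: compactum_hausdorff.
  exact: cts_fun.
have [|U [BU Ufx] UW] := bB (f x) (~` (f @` (~` W'))).
  apply: open_nbhs_nbhs; split; first exact: closed_openC.
  by move=> [z nW /fI zx]; apply: nW; rewrite zx.
exists (f @^-1` U); first by split=> //; exists U.
move=> z Uz; apply: W'W; apply: contrapT => nW; apply: (UW _ Uz).
by exists z.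
Qed.

Section weight.
Context (R : realType) (F : comp_functor).
Hypotheses (monoF : monomorphic F) (weightF : weight_preserving F).

Let unit_interval : set R := `[0%R, 1%R]%classic.

Let interval : compactum :=
  sub_compactum (@Rhausdorff R) (@segment_compact R 0%R 1%R).

Let interval_second_countable : @second_countable interval.
Proof.
have [] := @pseudometric_second_countable R (set_type (unit_interval : set R)).
  exact: (@compactum_compact interval).
by move=> B cB bB; exists B.
Qed.

Let inverse_sequence (n : nat) : unit_interval (n.+1%:R^-1)%R.
Proof.
by rewrite /unit_interval /= in_itv /= invr_ge0 ler0n invf_le1 ?ltr0n // ler1n.
Qed.

Let from_nat (n : nat) : interval := SigSub (mem_set (inverse_sequence n)).

Let from_nat_inj : injective from_nat.
Proof.
move=> m n /(congr1 val) /= /invr_inj /eqP; rewrite eqr_nat => /eqP.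
by case.
Qed.

Let interval_infinite : infinite_set [set: interval].
Proof.
move=> fI; apply: infinite_nat.
have -> : [set: nat] = from_nat @^-1` setT by [].
by apply: finite_preimage fI => m n _ _; exact: from_nat_inj.
Qed.

Let infinite_second_countable (X : compactum) : infinite_set [set: X] ->
  @second_countable X -> @second_countable (F X).
Proof.
move=> iX [B0 cB0 bB0]; have [B [C [[bB _] [_ minC] BC]]] := weightF iX.
exists B => //.
exact: card_le_trans (card_le_trans BC (minC _ bB0)) cB0.
Qed.

(* The hypothesis on the weight says nothing about finite spaces; these are
   handled by embedding them into an interval. *)
Lemma functor_second_countable (X : compactum) :
  @second_countable X -> @second_countable (F X).
Proof.
move=> cX; have [fX|] := pselect (finite_set [set: X]); last first.
  by move=> iX; exact: infinite_second_countable.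
have /countable_injP[h hI] := finite_set_countable fX.
pose e : continuousType X interval :=
  mkcts (@finite_continuous X interval (from_nat \o h) fX).
apply: (@second_countable_injective _ _ (fmap F e)).
  apply: monoF => x x' /from_nat_inj; apply: hI; exact: in_setT.
exact: infinite_second_countable.
Qed.

End weight.

(** * Rigid indices *)

Local Open Scope order_scope.

Lemma countableU (T : Type) (A B : set T) :
  countable A -> countable B -> countable (A `|` B).
Proof.
move=> cA cB; rewrite -bigcup2E; apply: bigcup_countable => // -[|[|n]] _ //=.
Qed.

Section rigid.
Context (d : Order.disp_t) (S : porderType d) (Y : spectrum S).
Hypotheses (dirS : directed [set: S]) (secS : forall a, @second_countable (Y a)).
Hypotheses (complS : omega_complete S) (contS : omega_continuous Y).
Hypothesis surjS : forall (a b : S) (ab : a <= b) y, exists x, bond Y ab x = y.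

Definition rigid (c : S) := forall (b : S) (cb : c <= b) (x x' : Y b),
  open [set bond Y cb x] -> bond Y cb x = bond Y cb x' -> x = x'.

Definition splits (s t : S) (st : s <= t) (y : Y s) :=
  exists x x', [/\ x <> x', bond Y st x = y & bond Y st x' = y].

Definition splitting (s t : S) := exists st : s <= t, forall y : Y s,
  open [set y] -> (exists b (sb : s <= b), splits sb y) -> splits st y.

Lemma splits_mono (s t u : S) (st : s <= t) (tu : t <= u) (su : s <= u) y :
  splits st y -> splits su y.
Proof.
move=> [x [x' [xx xy xy']]]; have [z zx] := surjS tu x.
have [z' zx'] := surjS tu x'.
exists z, z'; split; first by move=> zz; apply: xx; rewrite -zx -zx' zz.
  by rewrite -(bond_comp st tu) zx.
by rewrite -(bond_comp st tu) zx'.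
Qed.

(** Every basis contains all open singletons. *)
Lemma countable_isolated (X : topologicalType) :
  @second_countable X -> countable [set y : X | open [set y]].
Proof.
move=> [B cB [_ bB]].
have cI : countable [set [set y] | y in [set y : X | open [set y]]].
  apply: sub_countable cB; apply: subset_card_le => _ [y oy <-].
  have [|U [BU Uy] Uy1] := bB y [set y]; first exact: open_nbhs_nbhs.
  suff <- : U = [set y] by [].
  by apply/seteqP; split=> // _ ->.
have sI : {in [set y : X | open [set y]] &, injective (fun y => [set y])}.
  by move=> x y _ _ xy; have : [set y] x by rewrite -xy.
by rewrite -(eq_countable (inj_card_eq sI)).
Qed.

(** There are countably many isolated points, so the indices chosen to split them have a supremum,
    and by surjectivity of the bonds a point once split stays split. *)
Lemma splitting_exists (s : S) : exists u, s <= u /\ splitting s u.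
Proof.
have /choice[b bP] (y : Y s) : exists b, s <= b /\
    ((exists c (sc : s <= c), splits sc y) -> exists sb : s <= b, splits sb y).
  have [[c [sc sy]]|n] := pselect (exists c (sc : s <= c), splits sc y).
    by exists c; split=> // _; exists sc.
  by exists s.
(* Adjoining [s] gives [s <= u] even if [Y s] has no isolated point. *)
have [u [ubu _]] : exists u, isLub (b @` [set y : Y s | open [set y]] `|` [set s]) u.
  apply: complS; apply: countableU => //.
  by apply: sub_countable (card_image_le _ _) _; exact: countable_isolated.
have su : s <= u by apply: ubu; right.
exists u; split=> //; exists su => y oy /(bP y).2[sb sy].
have bu : b y <= u by apply: ubu; left; exists y.
exact: splits_mono bu su y sy.
Qed.

Lemma sup_separates (A : set S) (c : S) : isLub A c -> countable A -> directed A ->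
  forall x x' : Y c, (forall a (ac : a <= c), A a -> bond Y ac x = bond Y ac x') ->
  x = x'.
Proof.
move=> Ac cA dA x x' xx; have [_ [g [gK _ _]]] := contS Ac cA dA.
apply: (can_inj gK); apply: (iffRL (lim_map_inj _ _ _)) => a.
apply: xx; exact: set_valP.
Qed.

Lemma directed_set_type (A : set S) : directed A -> directed [set: set_type A].
Proof.
move=> [[a Aa] dA]; split; first by exists (SigSub (mem_set Aa)).
move=> b c _ _; have [u [Au bu cu]] := dA _ _ (set_valP b) (set_valP c).
by exists (SigSub (mem_set Au)).
Qed.

(** By compactness an open singleton of [Y c] is the full preimage of an open singleton of some
    [Y a] with [a] in [A]. If its point split above [c], the point of [Y a] would be split at a
    later member of [A], hence would have two preimages in [Y c]. *)
Lemma sup_rigid (A : set S) (c : S) : isLub A c -> countable A -> directed A ->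
  (forall a, A a -> exists2 b, A b & splitting a b) -> rigid c.
Proof.
move=> Ac cA dA splA b cb x x' ox xx'; apply: contrapT => nxx.
set y := bond Y cb x in ox xx'.
have [||a [V [oV Va VU]]] := @cone_nbhs _ (set_type A) (Y c) (fun a => Y (val a))
    (sub_bond Y Ac.1) (directed_set_type dA) _ _ [set y] y ox erefl.
- move=> a a' aa' z z' zz.
  by rewrite -!(@sub_bondP _ _ Y A c Ac.1 a a' aa') zz.
- move=> z z' zz; apply: (sup_separates Ac cA dA) => a ac Aa.
  rewrite (_ : ac = Ac.1 _ (set_valP (SigSub (mem_set Aa)))).
    exact: zz (SigSub (mem_set Aa)).
  exact: bool_irrelevance.
have ac : val a <= c by apply: Ac.1; exact: set_valP.
have bE z : sub_bond Y Ac.1 a z = bond Y ac z.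
  by rewrite /sub_bond; congr (bond Y _ z); exact: bool_irrelevance.
pose ya := bond Y ac y.
have oya : open [set ya].
  suff <- : V = [set ya] by [].
  apply/seteqP; split=> [v Vv|_ ->]; last by rewrite /ya -bE.
  have [z zv] := surjS ac v; have : [set y] z by apply: VU; rewrite bE zv.
  by move=> zy; rewrite -zv zy.
have [a' Aa' [aa' spl]] := splA _ (set_valP a).
have ab : val a <= b := le_trans ac cb.
have [|z [z' [zz zy zy']]] := spl ya oya.
  exists b, ab, x, x'; split=> //; rewrite -(bond_comp ac cb) //.
  by rewrite -xx'.
have ac' : a' <= c by exact: Ac.1.
have [w wz] := surjS ac' z; have [w' wz'] := surjS ac' z'.
have wy : w = y by apply: VU; rewrite bE -(bond_comp aa' ac') wz zy /ya -bE.
have wy' : w' = y by apply: VU; rewrite bE -(bond_comp aa' ac') wz' zy' /ya -bE.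
by apply: zz; rewrite -wz -wz' wy wy'.
Qed.

Lemma rigid_exists : exists c, rigid c.
Proof.
have /choice[g gP] := splitting_exists.
have [[s0 _] _] := dirS.
pose s n := iter n g s0.
have s_mono m n : (m <= n)%N -> s m <= s n.
  by move=> /subnK <-; elim: (n - m)%N => [//|k IH]; exact: le_trans IH (gP _).1.
have cs : countable (range s) by apply: sub_countable (card_image_le _ _) _.
have [c sc] := complS cs.
exists c; apply: sup_rigid sc cs _ _.
  split=> [|_ _ [m _ <-] [n _ <-]]; first by exists s0, 0%N.
  exists (s (maxn m n)); split; first by exists (maxn m n).
    by apply: s_mono; exact: leq_maxl.
  by apply: s_mono; exact: leq_maxr.
by move=> _ [n _ <-]; exists (s n.+1); [exists n.+1|exact: (gP _).2].
Qed.

(* A skeletal map sends isolated points to isolated points. *)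
Lemma rigid_up (a b : S) (ab : a <= b) :
  skeletal (bond Y ab) -> rigid a -> rigid b.
Proof.
move=> sk ra c bc x x' ox xx'.
have ac := le_trans ab bc; have abc z := bond_comp ab bc ac z.
apply: (ra c ac); last by rewrite -!abc xx'.
have cy := @hausdorff_closed1 _ (bond Y ac x).
have [nd|] := pselect (nowhere_dense [set bond Y ac x]).
  have : interior (closure (bond Y ab @^-1` [set bond Y ac x])) (bond Y bc x).
    have : nbhs (bond Y bc x) [set bond Y bc x] by exact: open_nbhs_nbhs.
    by apply: filterS => _ -> /=; apply: subset_closure; exact: abc.
  by rewrite (sk _ nd).
rewrite /nowhere_dense -(iffLR (closure_id _) cy) => /eqP/set0P[y iy].
suff <- : interior [set bond Y ac x] = [set bond Y ac x] by exact: open_interior.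
apply/seteqP; split=> [|_ ->]; first exact: interior_subset.
by have yE : y = bond Y ac x := interior_subset iy; rewrite -{2}yE.
Qed.

End rigid.

(** * The part of a spectrum above an index *)

Section tail.
Context (d : Order.disp_t) (S : porderType d) (Y : spectrum S) (c0 : S).
Hypotheses (dirS : directed [set: S]) (complS : omega_complete S).
Hypothesis contS : omega_continuous Y.

Let tail : set S := [set s | c0 <= s].

Lemma tail_directed : directed tail.
Proof.
split; first by exists c0; exact: lexx.
move=> a b ca cb; have [c [_ ac bc]] := dirS.2 a b I I.
by exists c; split=> //; exact: le_trans ca ac.
Qed.

Lemma tail_complete : omega_complete (set_type tail).
Proof.
move=> A cA.
(* Adjoining [c0] puts the supremum in the tail even for empty [A]. *)
have [|c [ubc lubc]] := complS (A := val @` A `|` [set c0]).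
  by apply: countableU => //; apply: sub_countable (card_image_le _ _) cA.
have tc : tail c by apply: ubc; right.
exists (SigSub (mem_set tc)); split=> [a Aa|b ub].
  by apply: ubc; left; exists a.
apply: lubc => _ [[a Aa <-]|->]; first exact: ub.
exact: (set_valP b).
Qed.

(** A directed [A] is nonempty, so each upper bound of it in [S] is above [c0] and belongs to the
    tail. *)
Lemma tail_lub (A : set (set_type tail)) (c : set_type tail) :
  isLub A c -> directed A -> isLub (val @` A) (val c).
Proof.
move=> [ubc lubc] [[a Aa] _]; split=> [_ [b Ab <-]|u ub]; first exact: ubc.
have tu : tail u.
  by apply: le_trans (set_valP a) _; apply: ub; exists a.
by apply: (lubc (SigSub (mem_set tu))) => b Ab; apply: ub; exists b.
Qed.

Lemma tail_sup_separates (A : set (set_type tail)) (c : set_type tail)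
    (Ac : isLub A c) : countable A -> directed A ->
  forall x x' : subspectrum Y tail c,
    (forall a, sub_bond (subspectrum Y tail) Ac.1 a x =
               sub_bond (subspectrum Y tail) Ac.1 a x') -> x = x'.
Proof.
move=> cA dA x x' xx.
apply: (sup_separates contS (tail_lub Ac dA)).
- exact: sub_countable (card_image_le _ _) cA.
- have [[a Aa] dA'] := dA; split; first by exists (val a), a.
  move=> _ _ [b Ab <-] [e Ae <-]; have [u [Au bu eu]] := dA' _ _ Ab Ae.
  by exists (val u); split=> //; exists u.
move=> _ /[swap] -[a Aa <-] ac.
rewrite (_ : ac = Ac.1 _ (set_valP (SigSub (mem_set Aa)))).
  exact: xx (SigSub (mem_set Aa)).
exact: bool_irrelevance.
Qed.

(** The tail is cofinal in the directed [S], so a thread over it extends uniquely to a thread over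
    [S]. *)
Lemma tail_limit : homeomorphic (lim_spectrum Y) (lim_spectrum (subspectrum Y tail)).
Proof.
pose q (a : set_type tail) : continuousType (lim_spectrum Y) (subspectrum Y tail a) :=
  lim_proj Y (val a).
have qP (a b : set_type tail) (ab : a <= b) x : bond (subspectrum Y tail) ab (q b x) = q a x.
  exact: (@lim_projP _ _ Y _ _ ab x).
have /choice[u uP] s : exists u : set_type tail, s <= val u.
  have [u [_ su cu]] := dirS.2 s c0 I I.
  by exists (SigSub (mem_set (cu : tail u))).
exists (lim_map qP); apply: bij_homeomorphism.
- exact: threads_hausdorff.
- exact: lim_map_continuous.
- move=> x x' /lim_map_inj xx; apply: val_inj; apply: functional_extensionality_dep => s.
  rewrite -[LHS](lim_projP (uP s)) -[RHS](lim_projP (uP s)).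
  by congr (bond Y _ _); exact: xx.
move=> z.
pose x : prod_topology (fun s : S => Y s) := fun s =>
  bond Y (uP s) (lim_proj (subspectrum Y tail) (u s) z).
(* The extension does not depend on the choice of [u s]: two tail indices above [s] are compared at
   a common upper bound. *)
have xE s (a : set_type tail) (sa : s <= val a) :
    bond Y sa (lim_proj (subspectrum Y tail) a z) = x s.
  have [b [_ ab ub]] := (directed_set_type tail_directed).2 a (u s) I I.
  rewrite /x -(lim_projP ab) -(lim_projP ub).
  have sb : s <= val b := le_trans sa ab.
  by rewrite (bond_comp sa ab sb) (bond_comp (uP s) ub sb).
have xT : @threads _ _ Y x.
  by move=> s t st; rewrite /x (bond_comp _ _ (le_trans st (uP t))) xE.
exists (SigSub (mem_set xT)); apply: val_inj; apply: functional_extensionality_dep => a.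
rewrite -[RHS]/(lim_proj (subspectrum Y tail) a z) -[LHS]/(x (val a)).
by rewrite -(xE _ _ (lexx (val a))) bond_id.
Qed.

End tail.

(** * Homeomorphism invariance and the spectrum of [F X] *)

Lemma homeomorphic_trans (X Y Z : topologicalType) :
  homeomorphic X Y -> homeomorphic Y Z -> homeomorphic X Z.
Proof.
move=> [f [cf [f' [fK f'K cf']]]] [g [cg [g' [gK g'K cg']]]].
exists (g \o f); split; first by move=> x; apply: continuous_comp; [exact: cf|exact: cg].
exists (f' \o g'); split; [exact: can_comp|exact: can_comp|].
by move=> x; apply: continuous_comp; [exact: cg'|exact: cf'].
Qed.

Lemma functor_homeomorphic (F : comp_functor) (X Y : compactum) :
  homeomorphic X Y -> homeomorphic (F X) (F Y).
Proof.
move=> [f [cf [g [fK gK cg]]]].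
pose f1 : continuousType X Y := mkcts cf; pose g1 : continuousType Y X := mkcts cg.
exists (fmap F f1); split; first exact: cts_fun.
exists (fmap F g1); split; last exact: cts_fun.
- have gfE x : (idfun : continuousType X X) x = g1 (f1 x) by exact: esym (fK x).
  by move=> a; rewrite -(@fmapE F _ _ _ g1 f1 _ gfE) fmap_idE.
- have fgE x : (idfun : continuousType Y Y) x = f1 (g1 x) by exact: esym (gK x).
  by move=> a; rewrite -(@fmapE F _ _ _ f1 g1 _ fgE) fmap_idE.
Qed.

Theorem theorem1p5 (R : realType) (F : comp_functor) (X : compactum) :
  mecw1 F -> skeletally_generated R X -> skeletally_generated R (F X).
Proof.
move=> [monoF epiF contF weightF preF].
move=> [d [S [Y [[dirS secS complS contS] mY bY XY]]]].
have surjS a b (ab : (a <= b)%O) y : exists x, bond Y ab x = y.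
  by have [/surjTP] := bY a b ab.
have [c0 c0_rigid] := rigid_exists dirS secS complS contS surjS.
pose T := [set s : S | (c0 <= s)%O]; pose Z := subspectrum Y T.
have dirT : directed [set: set_type T] := directed_set_type (tail_directed c0 dirS).
have secZ a : @second_countable (F (Z a)).
  exact: (@functor_second_countable R F monoF weightF _ (secS _)).
have epiZ a b (ab : (a <= b)%O) : set_surj setT setT (fmap F (bond Z ab)).
  by apply: epiF; apply/surjTP; exact: surjS.
exists _, (set_type T), (fspectrum F Z); split.
- split=> //; first exact: tail_complete.
  (* The bonds out of [Z c] separate points, by continuity of the given spectrum at [c]; their
     images under [F] still do and are onto, which suffices for a homeomorphism with the limit. *)
  move=> A c Ac cA dA; apply: lim_map_homeomorphism.
  + exact: directed_set_type.
  + apply: (@functor_separates F monoF contF _ _ (directed_set_type dA)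
      (subspectrum Z A) (Z c) (sub_bond Z Ac.1)).
      by move=> a b ab x; exact: sub_bondP.
    exact: tail_sup_separates.
  + by move=> a y; exact: (iffLR (surjTP _) (epiZ _ _ _) y).
- by move=> a; exact: second_countable_metrizable (secZ a).
- move=> a b ab; split; first exact: epiZ.
  apply: (@functor_skeletal R F monoF epiF contF preF).
  + exact: surjS.
  + by have [] := bY _ _ ab.
  + exact: mY.
  + have ra : rigid Y (val a) := rigid_up (bY _ _ (set_valP a)).2 c0_rigid.
    exact: (ra _ ab).
(* The chain passes from [F X] to [F] of the limit of [Y], then to [F] of the limit of the tail, and
   by continuity of [F] to the limit of the image spectrum. *)
- apply: homeomorphic_trans (functor_homeomorphic F XY) _.
  have YZ : homeomorphic (lim_spectrum Y) (lim_spectrum Z) := tail_limit Y c0 dirS.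
  apply: homeomorphic_trans (functor_homeomorphic F YZ) _.
  by exists (@flim_map F _ _ Z); exact: contF.
Qed.
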